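(* Let $s\in(0,1)$ and $c=1-2^{s-1}$. For any $X\in2^\omega$ with $\dim(X)=s$ and any $t\in(1-H(c),s)$, there is a sequence $Z$ with $\dim(Z)\le t$ and $$d(X,Z)\le\frac{c}{s-1+H(c)}(s-t).$$
   Context: $K$ is prefix-free Kolmogorov complexity; $\dim(X)=\liminf_nK(X\restriction n)/n$. $d(X,Z)=\limsup_n|\{m<n:X(m)\ne Z(m)\}|/n$. $H$ is binary entropy. *)

(* Defs.v *)
From mathcomp Require Import all_boot all_order all_algebra.
From mathcomp Require Import all_classical all_reals all_analysis.
Set Implicit Arguments. Unset Strict Implicit. Unset Printing Implicit Defensive.
Import Order.TTheory GRing.Theory Num.Theory.
Local Open Scope classical_set_scope.
Local Open Scope ring_scope.

Definition cpair (a b : nat) : nat := ((a + b) * (a + b).+1)./2 + b.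

(* Codes of unary partial recursive functions (with pairing as the way to
   handle several arguments). *)
Inductive pcode : Type :=
| cZero
| cSucc
| cFst
| cSnd
| cComp (f g : pcode)
| cPair (f g : pcode)
| cRec (f g : pcode)
| cMin (f : pcode).

Inductive eval : pcode -> nat -> nat -> Prop :=
| eZero x : eval cZero x 0
| eSucc x : eval cSucc x x.+1
| eFst a b : eval cFst (cpair a b) a
| eSnd a b : eval cSnd (cpair a b) b
| eComp f g x y z : eval g x y -> eval f y z -> eval (cComp f g) x z
| ePair f g x y z : eval f x y -> eval g x z -> eval (cPair f g) x (cpair y z)
| eRec0 f g x y : eval f x y -> eval (cRec f g) (cpair x 0) y
| eRecS f g x n y z : eval (cRec f g) (cpair x n) y ->
    eval g (cpair x (cpair n y)) z -> eval (cRec f g) (cpair x n.+1) z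
| eMin f x n : eval f (cpair x n) 0 ->
    (forall m, (m < n)%N -> exists k, eval f (cpair x m) k.+1) ->
    eval (cMin f) x n.

(* Bijective encoding of binary strings by natural numbers. *)
Fixpoint enc (s : seq bool) : nat :=
  match s with
  | [::] => 0
  | b :: s' => (enc s').*2 + 1 + b
  end.

Definition runs (c : pcode) (p sigma : seq bool) : Prop :=
  eval c (enc p) (enc sigma).

Definition prefix_free_machine (c : pcode) : Prop :=
  forall p q s1 s2, runs c p s1 -> runs c q s2 -> prefix p q -> p = q.

Definition optimal_pf_machine (U : pcode) : Prop :=
  prefix_free_machine U /\
  forall M : pcode, prefix_free_machine M ->
    exists C : nat, forall p sigma, runs M p sigma ->
      exists q, runs U q sigma /\ (size q <= size p + C)%N.

Definition KC {R : realType} (U : pcode) (sigma : seq bool) : R :=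
  inf [set (size p)%:R | p in [set p | runs U p sigma]].

Definition restr (X : nat -> bool) (n : nat) : seq bool := mkseq X n.

Definition dimK {R : realType} (U : pcode) (X : nat -> bool) : \bar R :=
  limn_einf (fun n => ((KC U (restr X n) : R) / n%:R)%:E).

Definition dist {R : realType} (X Z : nat -> bool) : \bar R :=
  limn_esup (fun n => ((#|[set m : 'I_n | X m != Z m]|)%:R / n%:R : R)%:E).

Definition Hbin {R : realType} (p : R) : R :=
  - p * (ln p / ln 2) - (1 - p) * (ln (1 - p) / ln 2).

(* Main.v *)
Require Import Defs.
From mathcomp Require Import all_boot all_order all_algebra.
From mathcomp Require Import all_classical all_reals all_analysis.
From mathcomp Require Import zify ring lra.
Import Order.TTheory GRing.Theory Num.Theory.

(** The sequence [Z] copies [X], except on rare blocks. At a late position [n]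
where the prefix of [X] has complexity about [s * n], the next [rho * n] bits,
cut into chunks of a fixed length [b], are replaced by the nearest words of a
covering code of radius [c * b] and rate [1 - H c]. The new prefix of length
[(1 + rho) * n] has complexity about [(s + (1 - H c) * rho) * n], which is
[t * (1 + rho) * n] for [rho = (s - t) / (t - (1 - H c))], while the proportion
of modified bits is at most [c * rho / (1 + rho)], the announced bound. Only
[0 < c < 1 / 2] matters here; [c = 1 - 2 `^ (s - 1)] is the optimal choice.

Each block may use its own prefix-free machine: the code table and the finite
part of [X] already modified are hard-wired in it, and its optimality constant
becomes negligible because [n] is chosen afterwards. *)

Local Open Scope nat_scope.

(** * Computable functions *)

(** Successor in the enumeration of pairs by [cpair], along antidiagonals; iterating it inverts
    [cpair] without any root extraction. *)
Definition unpair_step (ab : nat * nat) : nat * nat :=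
  if ab.1 is a.+1 then (a, ab.2.+1) else (ab.2.+1, 0).

Definition unpair (x : nat) : nat * nat := iter x unpair_step (0, 0).

Definition pfst x := (unpair x).1.
Definition psnd x := (unpair x).2.

Lemma half_triangleS n : (n.+1 * n.+2)./2 = (n * n.+1)./2 + n.+1.
Proof.
have -> : n.+1 * n.+2 = n.+1.*2 + n * n.+1.
  by rewrite -muln2 [n * _]mulnC -mulnDr.
by rewrite halfD odd_double /= doubleK add0n addnC.
Qed.

Lemma cpair_unpair x : cpair (pfst x) (psnd x) = x.
Proof.
have step a b : cpair (unpair_step (a, b)).1 (unpair_step (a, b)).2 = (cpair a b).+1.
  rewrite /unpair_step /cpair; case: a => [|a].
    by rewrite [in LHS]/fst [in LHS]/snd !addn0 add0n half_triangleS addnS.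
  by rewrite [in LHS]/fst [in LHS]/snd addnS addSn addnS.
rewrite /pfst /psnd; elim: x => [//|x IH]; rewrite /unpair iterS -/(unpair x).
by rewrite (surjective_pairing (unpair x)) step IH.
Qed.

Lemma cpair_lt a b a' b' : a + b < a' + b' -> cpair a b < cpair a' b'.
Proof.
move=> lt; rewrite /cpair.
have mono m n : m <= n -> (m * m.+1)./2 <= (n * n.+1)./2.
  by move=> mn; rewrite half_leq// leq_mul.
have := mono _ _ lt; rewrite half_triangleS; lia.
Qed.

Lemma cpair_inj a b a' b' : cpair a b = cpair a' b' -> a = a' /\ b = b'.
Proof.
move=> e.
have e2 : a + b = a' + b'.
  case: (ltngtP (a + b) (a' + b')) => // /cpair_lt; rewrite e; lia.
by move: e; rewrite /cpair e2; lia.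
Qed.

Lemma pfst_cpair a b : pfst (cpair a b) = a.
Proof. by case: (cpair_inj _ _ _ _ (cpair_unpair (cpair a b))). Qed.

Lemma psnd_cpair a b : psnd (cpair a b) = b.
Proof. by case: (cpair_inj _ _ _ _ (cpair_unpair (cpair a b))). Qed.

Lemma eval_rec_inv f g x n y : Defs.eval (cRec f g) (cpair x n) y ->
  if n is m.+1 then
    exists z, Defs.eval (cRec f g) (cpair x m) z /\ Defs.eval g (cpair x (cpair m z)) y
  else Defs.eval f x y.
Proof.
move ec: (cRec f g) => c; move ev: (cpair x n) => v E.
case: c v y / E ec ev => // [f' g' x' y E | f' g' x' m y z E1 E2] [ef eg] /cpair_inj[ex en].
  by subst.
by subst; exists y.
Qed.

(** Induction on the code. For [cMin], the smaller of two distinct outputs would be a zero of [f] by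
    one run and a point of positive value by the other. *)
Lemma eval_det c x y y' : Defs.eval c x y -> Defs.eval c x y' -> y = y'.
Proof.
elim: c x y y' => [|||| f IHf g IHg | f IHf g IHg | f IHf g IHg | f IHf] x y y' E E'.
- by inversion E; inversion E'.
- by inversion E; inversion E'; subst.
- inversion E; inversion E'; subst.
  by match goal with H : cpair _ _ = cpair _ _ |- _ => case: (cpair_inj _ _ _ _ H) end.
- inversion E; inversion E'; subst.
  by match goal with H : cpair _ _ = cpair _ _ |- _ => case: (cpair_inj _ _ _ _ H) end.
- inversion E as [| | | |? ? ? v ? E1 E2| | | |]; subst.
  inversion E' as [| | | |? ? ? v' ? E1' E2'| | | |]; subst.
  by move: (IHg _ _ _ E1 E1') => e; subst; exact: IHf E2 E2'.
- inversion E as [| | | | |? ? ? v1 v2 E1 E2| | |]; subst.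
  inversion E' as [| | | | |? ? ? v1' v2' E1' E2'| | |]; subst.
  by rewrite (IHf _ _ _ E1 E1') (IHg _ _ _ E2 E2').
- rewrite -(cpair_unpair x) in E E'; move: (pfst x) (psnd x) E E' => {}x n.
  elim: n y y' => [|n IHn] y y' /eval_rec_inv E /eval_rec_inv E'; first exact: IHf E E'.
  case: E E' => z [E1 E2] [z' [E1' E2']].
  by rewrite -(IHn _ _ E1 E1') in E2'; exact: IHg E2 E2'.
- inversion E as [| | | | | | | |? ? ? E1 E2]; subst.
  inversion E' as [| | | | | | | |? ? ? E1' E2']; subst.
  case: (ltngtP y y') => // lt.
    by case: (E2' _ lt) => k /(IHf _ _ _ E1).
  by case: (E2 _ lt) => k /(IHf _ _ _ E1').
Qed.

Definition computable (f : nat -> nat) := exists c, forall x, Defs.eval c x (f x).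

Lemma computable_ext f g : f =1 g -> computable f -> computable g.
Proof. by move=> fg [c cP]; exists c => x; rewrite -fg. Qed.

Lemma computable_succ : computable succn.
Proof. by exists cSucc => x; constructor. Qed.

Lemma computable_fst : computable pfst.
Proof. by exists cFst => x; rewrite -{1}(cpair_unpair x); constructor. Qed.

Lemma computable_snd : computable psnd.
Proof. by exists cSnd => x; rewrite -{1}(cpair_unpair x); constructor. Qed.

Lemma computable_comp f g :
  computable f -> computable g -> computable (fun x => f (g x)).
Proof. by move=> [a aP] [b bP]; exists (cComp a b) => x; econstructor. Qed.

Lemma computable_pair f g :
  computable f -> computable g -> computable (fun x => cpair (f x) (g x)).
Proof. by move=> [a aP] [b bP]; exists (cPair a b) => x; constructor. Qed.

Lemma computable_id : computable id.
Proof.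
apply: (computable_ext (fun x => cpair (pfst x) (psnd x))).
  exact: cpair_unpair.
exact: computable_pair computable_fst computable_snd.
Qed.

Lemma computable_const n : computable (fun=> n).
Proof.
elim: n => [|n IH]; first by exists cZero => x; constructor.
exact: computable_comp computable_succ IH.
Qed.

Lemma computable_rec f g h : computable f -> computable g -> computable h ->
  computable (fun x =>
    nat_rect (fun=> nat) (f x) (fun k r => g (cpair x (cpair k r))) (h x)).
Proof.
move=> [a aP] [b bP] ch.
have [d dP] := computable_pair _ _ computable_id ch.
exists (cComp (cRec a b) d) => x; econstructor; first exact: dP.
elim: (h x) => [|n IH] /=; first by constructor.
by econstructor; [exact: IH | exact: bP].
Qed.

Lemma computable_iter f g h : computable f -> computable g -> computable h ->
  computable (fun x => iter (h x) g (f x)).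
Proof.
move=> cf cg ch.
apply: (computable_ext _ _ _ (computable_rec f (fun x => g (psnd (psnd x))) h cf _ ch)).
- by move=> x; elim: (h x) => //= n ->; rewrite !psnd_cpair.
- do 2!apply: computable_comp => //; exact: computable_snd.
Qed.

Lemma computable_case f g h : computable f -> computable g -> computable h ->
  computable (fun x => if h x is k.+1 then g (cpair x k) else f x).
Proof.
move=> cf cg ch.
have cg' : computable (fun x => g (cpair (pfst x) (pfst (psnd x)))).
  apply: computable_comp => //; apply: computable_pair; first exact: computable_fst.
  exact: computable_comp computable_fst computable_snd.
apply: (computable_ext _ _ _ (computable_rec _ _ _ cf cg' ch)) => x.
by case: (h x) => //= n; rewrite !(pfst_cpair, psnd_cpair).
Qed.

Lemma computable_add f g :
  computable f -> computable g -> computable (fun x => f x + g x).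
Proof.
move=> cf cg; apply: (computable_ext _ _ _ (computable_iter f succn g cf computable_succ cg)).
by move=> x; rewrite iter_succn.
Qed.

Lemma computable_sub f g :
  computable f -> computable g -> computable (fun x => f x - g x).
Proof.
move=> cf cg.
have cp : computable predn.
  have := computable_case _ _ _ (computable_const 0) computable_snd computable_id.
  by apply: computable_ext => -[|n] //=; rewrite psnd_cpair.
apply: (computable_ext _ _ _ (computable_iter f predn g cf cp cg)).
by move=> x; rewrite iter_predn.
Qed.

(** A relation between input and output, since the search diverges when there is no solution. *)
Definition search_code (e : pcode) (f g : nat -> nat) :=
  forall x y, Defs.eval e x y <-> f y = g x /\ forall z, z < y -> f z <> g x.

Lemma computable_search f g : computable f -> computable g ->
  exists e, search_code e f g.
Proof.
move=> cf cg.
(* The two truncated differences add up to a distance, zero exactly when the values agree. *)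
pose t x := (f (psnd x) - g (pfst x)) + (g (pfst x) - f (psnd x)).
have ct : computable t.
  have cf' := computable_comp _ _ cf computable_snd.
  have cg' := computable_comp _ _ cg computable_fst.
  by apply: computable_add; apply: computable_sub.
have [a aP] := ct; exists (cMin a) => x y.
have tP z : t (cpair x z) = 0 <-> f z = g x.
  by rewrite /t psnd_cpair pfst_cpair; lia.
split=> [E|[e lt]].
  inversion E as [| | | | | | | |? ? ? E1 E2]; subst; split.
    by apply/tP; exact: eval_det (aP _) E1.
  move=> z /E2[k Ek] /tP tz.
  by have := eval_det _ _ _ _ (aP _) Ek; rewrite tz.
constructor; first by have := aP (cpair x y); rewrite (iffRL (tP y) e).
move=> z /lt fz; exists (t (cpair x z)).-1.
rewrite prednK//; by case E: (t _) => //; case: fz; apply/tP.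
Qed.

(** * Operations on codes of binary strings *)

Definition prep (w : seq bool) (x : nat) : nat :=
  foldr (fun (b : bool) y => y.*2 + 1 + b) x w.

Lemma enc_cat w s : enc (w ++ s) = prep w (enc s).
Proof. by elim: w => //= b w ->. Qed.

Lemma enc_inj : injective enc.
Proof.
elim=> [|b s IH] [|b' s'] //=; try lia.
move=> e; have /IH <- : enc s = enc s' by case: b b' e => -[] /=; lia.
by congr (_ :: _); case: b b' e => -[] /=; lia.
Qed.

Lemma enc_surj x : exists s, enc s = x.
Proof.
elim/ltn_ind: x => -[|x] IH; first by exists [::].
have [|s es] := IH x./2; first by lia.
by exists (odd x :: s); rewrite /= es -{3}(odd_double_half x); lia.
Qed.

Lemma computable_prep w f : computable f -> computable (fun x => prep w (f x)).
Proof.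
move=> cf; elim: w => //= b w IH.
apply: computable_add; last exact: computable_const.
apply: computable_add; last exact: computable_const.
by apply: (computable_ext _ _ _ (computable_add _ _ IH IH)) => x; rewrite addnn.
Qed.

(* Out-of-range indices denote the first word, so that every index is legal. *)
Definition word (T : seq (seq bool)) (i : nat) := nth (head [::] T) T i.

(* [assemble T] reads [m] table indices from the code [w] and prepends the
   corresponding words of the table [T] to the word coded by [x]. *)
Definition assemble_step (T : seq (seq bool)) (z : nat) : nat :=
  cpair (psnd (pfst z)) (prep (word T (pfst (pfst z))) (psnd z)).

Definition assemble T (w m x : nat) : nat :=
  psnd (iter m (assemble_step T) (cpair w x)).

(** [assemble] prepends, so the index that it reads first comes last; hence [rcons]. *)
Fixpoint indices (w m : nat) : seq nat :=
  if m is m'.+1 then rcons (indices (psnd w) m') (pfst w) else [::].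

Lemma indices_surj l : exists w, indices w (size l) = l.
Proof.
elim/last_ind: l => [|l i [w IH]]; first by exists 0.
by exists (cpair i w); rewrite size_rcons /= psnd_cpair pfst_cpair IH.
Qed.

Definition subst_words (T : seq (seq bool)) (l : seq nat) : seq bool :=
  flatten [seq word T i | i <- l].

Lemma assembleE T w m s :
  assemble T w m (enc s) = enc (subst_words T (indices w m) ++ s).
Proof.
rewrite /assemble /subst_words; elim: m w s => [|m IH] w s.
  by rewrite /= psnd_cpair.
rewrite iterSr /assemble_step !(pfst_cpair, psnd_cpair) -enc_cat IH /=.
by rewrite map_rcons flatten_rcons catA.
Qed.

Lemma computable_assemble T f g h : computable f -> computable g -> computable h ->
  computable (fun x => assemble T (f x) (g x) (h x)).
Proof.
move=> cf cg ch; apply: (computable_comp psnd); first exact: computable_snd.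
apply: computable_iter => //; first exact: computable_pair.
apply: computable_pair; first exact: computable_comp computable_snd computable_fst.
(* Lookup in a fixed finite table is a nest of case distinctions on the index. The default [d] is
   generalised because [word] takes it from the head of the whole table. *)
have cT d k l : computable k -> computable l ->
    computable (fun x => prep (nth d T (k x)) (l x)).
  elim: T k l => [|w T IH] k l ck cl.
    by apply: computable_ext (computable_prep d _ cl) => x; rewrite nth_nil.
  have c1 := computable_prep w _ cl.
  have c2 := IH psnd (fun x => l (pfst x)) computable_snd
    (computable_comp _ _ cl computable_fst).
  apply: (computable_ext _ _ _ (computable_case _ _ _ c1 c2 ck)) => x.
  by case: (k x) => //= n; rewrite psnd_cpair pfst_cpair.
apply: cT; last exact: computable_snd.
exact: computable_comp computable_fst computable_fst.
Qed.

(** * Prefix-free machines with a hard-wired code table *)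

Definition marked (e : nat) (x : seq bool) := size x = e /\ head false x.

Lemma prefix_cat_size (T : eqType) (x x' y y' : seq T) :
  size x = size x' -> prefix (x ++ y) (x' ++ y') -> x = x' /\ prefix y y'.
Proof.
elim: x x' => [|a x IH] [|a' x'] //= [/IH{}IH].
by case: eqP => //= -> /IH[-> ->].
Qed.

(** The parse is forced: at each boundary, the bit [true] announces another word of known length
    [e], and [false] ends the list. *)
Lemma prefix_marked e L L' p p' :
  {in L, forall x, marked e x} -> {in L', forall x, marked e x} ->
  prefix (flatten L ++ false :: p) (flatten L' ++ false :: p') ->
  L = L' /\ prefix p p'.
Proof.
elim: L L' => [|x L IH] [|x' L'] mL mL'.
- by [].
- have [] := mL' _ (mem_head _ _); case: x' {mL'} => //= b x' _; by case: b.
- have [] := mL _ (mem_head _ _); case: x {mL} => //= b x _; by case: b.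
have [sx _] := mL _ (mem_head _ _); have [sx' _] := mL' _ (mem_head _ _).
rewrite /= -!catA => /prefix_cat_size[|-> /IH[||-> //]]; first by rewrite sx.
- by move=> y yL; apply: mL; rewrite inE yL orbT.
- by move=> y yL; apply: mL'; rewrite inE yL orbT.
Qed.

Section machine.
Variables (U : pcode) (hU : prefix_free_machine U) (e : nat).
Variables (A B : seq (seq bool)) (u w : seq bool).
Hypothesis mA : forall i, marked e (word A i).
Hypothesis AB : forall i j, word A i = word A j -> word B i = word B j.

(** A candidate parse [z] packs the code of a program with the code and the length of a list of
    indices; [input z] is the code of the input so parsed. *)
Let input z := assemble A (pfst (psnd z)) (psnd (psnd z)) (prep [:: false] (pfst z)).
Let list z := indices (pfst (psnd z)) (psnd (psnd z)).

Let inputE z p : pfst z = enc p -> input z = enc (subst_words A (list z) ++ false :: p).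
Proof. by move=> zp; rewrite /input zp -enc_cat assembleE. Qed.

Let input_prefix l l' p p' :
  prefix (subst_words A l ++ false :: p) (subst_words A l' ++ false :: p') ->
  map (word A) l = map (word A) l' /\ prefix p p'.
Proof. by apply: prefix_marked => _ /mapP[i _ ->]; exact: mA. Qed.

Let input_inj l l' p p' :
  subst_words A l ++ false :: p = subst_words A l' ++ false :: p' ->
  map (word A) l = map (word A) l' /\ p = p'.
Proof.
move=> e1; have [] := @input_prefix l l' p p'; first by rewrite e1 prefix_refl.
move=> e2 _; split=> //; move: e1; rewrite /subst_words e2 => /eqP.
by rewrite eqseq_cat// eqxx => /eqP[].
Qed.

(** A string is also a list of indices into this table, so [assemble] serves to enumerate all
    strings. *)
Let bits := [:: [:: false]; [:: true]].

Let bits_surj s : exists v, subst_words bits (indices v (size s)) = s.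
Proof.
have [v] := indices_surj [seq nat_of_bool b | b <- s].
rewrite size_map => ev; exists v; rewrite ev /subst_words => {ev}.
by elim: s => [//|[] s /= ->].
Qed.

Let guess y := prep u (assemble bits (pfst y) (psnd y) 0).

Let guessE y : guess y = enc (u ++ subst_words bits (indices (pfst y) (psnd y))).
Proof. by rewrite /guess -[0]/(enc [::]) assembleE cats0 enc_cat. Qed.

(* An input is a sequence of marked words of [A] (each starting with [true] and
   of length [e]), then [false], then a program of [U]: such strings form a
   prefix-free set because the domain of [U] is one. The machine finds the
   parse, and later the bits of [s], by unbounded search. *)
Lemma append_machine : exists M, prefix_free_machine M /\
  forall p s l, runs U p (u ++ s) ->
    runs M (subst_words A l ++ false :: p) (w ++ s ++ subst_words B l).
Proof.
have cin : computable input.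
  have c2 := computable_snd; have c1 := computable_fst.
  apply: computable_assemble; [exact: computable_comp c1 c2|by apply: computable_comp|].
  exact: computable_prep.
have [m1 m1P] := computable_search _ _ cin computable_id.
have cg : computable guess.
  apply: computable_prep; apply: computable_assemble.
  - exact: computable_fst.
  - exact: computable_snd.
  - exact: computable_const.
have [m2 m2P] := computable_search _ _ cg computable_snd.
have [cid cidP] := computable_id.
pose out x := let z := pfst (pfst x) in let y := psnd x in
  prep w (assemble bits (pfst y) (psnd y)
    (assemble B (pfst (psnd z)) (psnd (psnd z)) 0)).
have [co coP] : computable out.
  have c2 := computable_snd; have c1 := computable_fst.
  have c11 : computable (fun x => pfst (pfst x)) by apply: computable_comp.
  have c211 := computable_comp _ _ c2 c11.
  apply: computable_prep; apply: computable_assemble.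
  - exact: computable_comp c1 c2.
  - by apply: computable_comp.
  - apply: computable_assemble; last exact: computable_const.
    + exact: computable_comp c1 c211.
    + exact: computable_comp c2 c211.
(* From right to left: parse the input, run [U] on the program found, search for the string
   following [u] in its output, write the result. Each stage keeps the earlier values in a pair. *)
pose M := cComp co (cComp (cPair cid m2) (cComp (cPair cid (cComp U cFst)) m1)).
have MP q t : runs M q t <-> exists z r y,
    [/\ Defs.eval m1 (enc q) z, Defs.eval U (pfst z) r,
        Defs.eval m2 (cpair z r) y & out (cpair (cpair z r) y) = enc t].
  split=> [E|[z [r [y [E1 E2 E3 E4]]]]].
    inversion E as [| | | |? ? ? v ? E1 E2| | | |]; subst.
    inversion E1 as [| | | |? ? ? v' ? E3 E4| | | |]; subst.
    inversion E3 as [| | | |? ? ? z ? E5 E6| | | |]; subst.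
    inversion E6 as [| | | | |? ? ? v1 r E7 E8| | |]; subst.
    inversion E4 as [| | | | |? ? ? v3 y E9 E10| | |]; subst.
    inversion E8 as [| | | |? ? ? v5 ? E11 E12| | | |]; subst.
    move: (eval_det _ _ _ _ (cidP _) E9) => e1; subst.
    move: (eval_det _ _ _ _ (cidP _) E7) => e2; subst.
    exists v1, r, y; split=> //; last exact: eval_det (coP _) E2.
    suff -> : pfst v1 = v5 by [].
    apply: eval_det E11.
    by rewrite -{1}(cpair_unpair v1); constructor.
  rewrite /runs -E4; apply: (@eComp _ _ _ (cpair (cpair z r) y)); last exact: coP.
  apply: (@eComp _ _ _ (cpair z r)); last by constructor.
  apply: (@eComp _ _ _ z) => //; constructor => //.
  apply: (@eComp _ _ _ (pfst z)) => //.
  by rewrite -{1}(cpair_unpair z); constructor.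
have dom q t : runs M q t -> exists l p r,
    q = subst_words A l ++ false :: p /\ runs U p r.
  move=> /MP[z [r [y [E1 E2 _ _]]]].
  have [p ep] := enc_surj (pfst z); have [r' er] := enc_surj r.
  exists (list z), p, r'; rewrite /runs ep er; split=> //.
  by apply: enc_inj; rewrite -inputE//; case/m1P: E1.
exists M; split.
  move=> q q' t t' /dom[l [p [r [-> Ur]]]] /dom[l' [p' [r' [-> Ur']]]].
  move=> /input_prefix[el /(hU _ _ _ _ Ur Ur') ->].
  by rewrite /subst_words el.
move=> p s l Up; apply/MP.
set q := _ ++ _.
have [z E1] : exists z, Defs.eval m1 (enc q) z.
  have [v ev] := indices_surj l.
  have ex : exists z, input z == enc q.
    exists (cpair (enc p) (cpair v (size l))).
    by rewrite (inputE _ p) ?pfst_cpair// /list psnd_cpair pfst_cpair psnd_cpair ev.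
  exists (ex_minn ex); apply/m1P; case: ex_minnP => z /eqP-> zmin; split=> // z' lt.
  by move=> /eqP/zmin; rewrite leqNgt lt.
have [p' ep] := enc_surj (pfst z).
have [el pp] : map (word A) (list z) = map (word A) l /\ p' = p.
  by apply: input_inj; apply: enc_inj; rewrite -inputE//; case/m1P: E1.
subst p'.
(* The search may return indices other than [l], but they name the same words of [A], hence by [AB]
   the same words of [B]. *)
have eB : subst_words B (list z) = subst_words B l.
  rewrite /subst_words; congr flatten; elim: (list z) l {q E1 Up} el => [|i k IH] [|j l] //= [].
  by move=> /AB -> /IH ->.
have [y E2] : exists y, Defs.eval m2 (cpair z (enc (u ++ s))) y.
  have [v ev] := bits_surj s.
  have ex : exists y, guess y == enc (u ++ s).
    by exists (cpair v (size s)); rewrite guessE pfst_cpair psnd_cpair ev.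
  exists (ex_minn ex); apply/m2P; rewrite psnd_cpair.
  case: ex_minnP => y /eqP-> ymin; split=> // y' lt.
  by move=> /eqP/ymin; rewrite leqNgt lt.
exists z, (enc (u ++ s)), y; split=> //; first by rewrite -ep.
rewrite /out !(pfst_cpair, psnd_cpair) -[X in assemble B _ _ X]/(enc [::]).
rewrite assembleE cats0 assembleE -enc_cat eB.
case/m2P: E2 => + _; rewrite psnd_cpair guessE => /enc_inj/eqP.
by rewrite eqseq_cat// eqxx => /eqP ->.
Qed.
End machine.

(** * Covering codes *)

Definition hamming (b : nat) (x y : {set 'I_b}) : nat :=
  #|[set i | (i \in x) != (i \in y)]%SET|.

(** Symmetric difference with [x] is an involution that carries the sphere around [x] onto the
    [k]-subsets. *)
Lemma card_sphere b k (x : {set 'I_b}) :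
  #|[set y | hamming b x y == k]%SET| = 'C(b, k).
Proof.
pose f (y : {set 'I_b}) := [set i | (i \in x) != (i \in y)]%SET.
have fK : involutive f.
  by move=> y; apply/setP => i; rewrite !inE; case: (i \in x); case: (i \in y).
rewrite -[b in RHS]card_ord -card_draws.
rewrite -[RHS](card_preimset _ (inv_inj fK)).
by apply: eq_card => y; rewrite !inE.
Qed.

Definition uncovered b k (l : seq {set 'I_b}) : {set {set 'I_b}} :=
  [set x | all (fun y => hamming b x y != k) l]%SET.

Lemma card_subsets b : #|{: {set 'I_b}}| = 2 ^ b.
Proof. by rewrite -cardsT -powersetT card_powerset cardsT card_ord. Qed.

(** Averaging over centres: each point of [S] is missed by exactly [2 ^ b - 'C(b, k)] centres, and a
    best centre does no worse than the mean. *)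
Lemma greedy_step b k (S : {set {set 'I_b}}) : exists y : {set 'I_b},
  #|[set x in S | hamming b x y != k]%SET| * 2 ^ b <= #|S| * (2 ^ b - 'C(b, k)).
Proof.
have card_cond (T : finType) (A B : {pred T}) :
    #|[set x in A | x \in B]%SET| = \sum_(x in A) (x \in B).
  rewrite -sum1_card (eq_bigl (fun x => (x \in A) && (x \in B))); last by move=> x; rewrite inE.
  by rewrite big_mkcondr; apply: eq_bigr => x _; case: (_ \in _).
have dc : \sum_(y : {set 'I_b}) #|[set x in S | hamming b x y != k]%SET|
        = #|S| * (2 ^ b - 'C(b, k)).
  under eq_bigr => y _ do rewrite (card_cond _ _ [pred x | hamming b x y != k]).
  rewrite exchange_big /= -sum_nat_const; apply: eq_bigr => x _.
  rewrite -(card_sphere b k x) -card_subsets -(cardsC [set y | hamming b x y == k]%SET) addKn.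
  rewrite -sum1_card [RHS]big_mkcond; apply: eq_bigr => y _.
  by rewrite !inE; case: (_ == _).
pose f (y : {set 'I_b}) := #|[set x in S | hamming b x y != k]%SET|.
case: (arg_minnP f (isT : xpredT (finset.set0 : {set 'I_b}))) => y _ ymin; exists y.
rewrite -dc -card_subsets mulnC -sum_nat_const.
by apply: leq_sum => z _; exact: ymin.
Qed.

Lemma greedy_cover b k N : exists l : seq {set 'I_b},
  size l = N /\ #|uncovered b k l| * (2 ^ b) ^ N <= 2 ^ b * (2 ^ b - 'C(b, k)) ^ N.
Proof.
elim: N => [|N [l [sl IH]]].
  exists [::]; split=> //; rewrite !expn0 !muln1.
  by rewrite -card_subsets max_card.
have [y hy] := greedy_step b k (uncovered b k l).
exists (y :: l); split; first by rewrite /= sl.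
have -> : uncovered b k (y :: l) = [set x in uncovered b k l | hamming b x y != k]%SET.
  by apply/setP => x; rewrite !inE andbC.
rewrite expnS mulnA; apply: leq_trans (leq_mul hy (leqnn _)) _.
by rewrite mulnAC expnSr mulnA leq_mul2r IH orbT.
Qed.

Local Open Scope ring_scope.

(* The binomial distribution has its mode at the integer part of [(b + 1) c],
   and its [b + 1] weights sum to [1]. *)
Lemma binomial_mode (R : realType) (c : R) (b k : nat) :
  0 < c < 1 -> k%:R <= b.+1%:R * c < k.+1%:R ->
  1 <= b.+1%:R * ('C(b, k)%:R * (c ^+ k * (1 - c) ^+ (b - k))).
Proof.
move=> /andP[c0 c1] /andP[kle klt].
pose T j : R := 'C(b, j)%:R * (c ^+ j * (1 - c) ^+ (b - j)).
have d0 : 0 < 1 - c by rewrite subr_gt0.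
have T0 j : 0 <= T j by rewrite !mulr_ge0 ?exprn_ge0// ltW.
have step j : (j < b)%N -> T j.+1 * (j.+1%:R * (1 - c)) = T j * ((b - j)%:R * c).
  move=> jb; rewrite /T.
  have -> : (b - j = (b - j.+1).+1)%N by lia.
  have e : (j.+1 * 'C(b, j.+1) = (b - j.+1).+1 * 'C(b, j))%N.
    by rewrite mul_bin_left; congr (_ * _)%N; lia.
  have {}e : j.+1%:R * 'C(b, j.+1)%:R = (b - j.+1).+1%:R * 'C(b, j)%:R :> R.
    by rewrite -!natrM e.
  rewrite !exprS; transitivity (j.+1%:R * 'C(b, j.+1)%:R *
    (c * c ^+ j * (1 - c) ^+ (b - j.+1) * (1 - c))); first by ring.
  by rewrite e; ring.
(* The sign of this difference decides whether the weights grow from [j] to [j.+1]: they do up to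
   [k] and no longer afterwards. *)
have bj j : (j < b)%N -> (b - j)%:R * c - j.+1%:R * (1 - c) = b.+1%:R * c - j.+1%:R.
  by move=> jb; rewrite natrB 1?ltnW// -!natr1; ring.
have up j : (j < b)%N -> (j < k)%N -> T j <= T j.+1.
  move=> jb jk; have := bj _ jb; have := step _ jb.
  have h : j.+1%:R <= b.+1%:R * c by apply: le_trans kle; rewrite ler_nat.
  have p : 0 < j.+1%:R * (1 - c) by rewrite mulr_gt0// ltr0n.
  move=> e1 e2; rewrite -(ler_pM2r p) e1 ler_wpM2l// -subr_ge0 e2; lra.
have down j : (j < b)%N -> (k <= j)%N -> T j.+1 <= T j.
  move=> jb jk; have := bj _ jb; have := step _ jb.
  have h : b.+1%:R * c < j.+1%:R by apply: lt_le_trans klt _; rewrite ler_nat.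
  have p : 0 < j.+1%:R * (1 - c) by rewrite mulr_gt0// ltr0n.
  move=> e1 e2; rewrite -(ler_pM2r p) e1 ler_wpM2l// -subr_ge0 -opprB e2; lra.
have Tk j : (j <= b)%N -> T j <= T k.
  move=> jb; case: (leqP k j) => kj.
    have := jb; rewrite -(subnKC kj); elim: (j - k)%N => [|i IH]; first by rewrite addn0.
    rewrite addnS => lt; apply: le_trans (IH (ltnW lt)).
    by apply: down => //; rewrite leq_addr.
  have kb : (k <= b)%N.
    by rewrite -ltnS -(ltr_nat R); apply: le_lt_trans kle _; rewrite gtr_pMr// ltr0n.
  have mono i : (j + i <= k)%N -> T j <= T (j + i)%N.
    elim: i => [|i IH] ik; first by rewrite addn0.
    by apply: le_trans (IH _) _; [lia | rewrite addnS; apply: up; lia].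
  by rewrite -(subnKC (ltnW kj)); apply: mono; lia.
rewrite -[leLHS](_ : \sum_(j < b.+1) T j = 1).
  rewrite -[leRHS]/(b.+1%:R * T k) mulr_natl -[X in _ *+ X]card_ord -sumr_const.
  by apply: ler_sum => j _; apply: Tk; rewrite -ltnS.
rewrite -[RHS](expr1n _ b) -[in RHS](subrK c 1) exprDn.
by apply: eq_bigr => j _; rewrite -mulr_natl /T; ring.
Qed.

(** With [V = 'C(b, k)], the greedy choice leaves at most [2^b (1 - V / 2^b)^N <= 2^b exp(-b) < 1]
    points uncovered. *)
Lemma covering_of_volume (R : realType) (b k N : nat) : (0 < b)%N ->
  (b * 2 ^ b <= 'C(b, k) * N)%N ->
  exists2 l : seq {set 'I_b}, size l = N & forall x, has (fun y => hamming b x y == k) l.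
Proof.
move=> b0 hN; have [l [sl hl]] := greedy_cover b k N; exists l => // x.
suff : uncovered b k l == finset.set0.
  by move=> /eqP/setP/(_ x); rewrite !inE all_predC => /negbFE.
rewrite -cards_eq0 -leqn0 -ltnS; move: hl; set u := #|_|.
have Vle : ('C(b, k) <= 2 ^ b)%N.
  by rewrite -(card_sphere _ _ finset.set0) -card_subsets max_card.
case: u => // u hl; exfalso; move: hl; apply/negP; rewrite -ltnNge.
apply: (@leq_trans ((2 ^ b) ^ N)); last by rewrite leq_pmull.
rewrite -(ltr_nat R) natrM !natrX natrB// natrX.
set V : R := 'C(b, k)%:R; have q0 : 0 < 2 ^+ b :> R by rewrite exprn_gt0.
have v1 : 0 <= 1 - V / 2 ^+ b.
  by rewrite subr_ge0 ler_pdivrMr// mul1r -natrX ler_nat.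
have -> : 2 ^+ b - V = 2 ^+ b * (1 - V / 2 ^+ b).
  by rewrite mulrBr mulr1 mulrCA divff ?mulr1// gt_eqF.
rewrite exprMn mulrCA gtr_pMr ?exprn_gt0//.
have le1 : (1 - V / 2 ^+ b) ^+ N <= expR (- b%:R).
  apply: (@le_trans _ _ (expR (- (V / 2 ^+ b)) ^+ N)).
    by rewrite lerXn2r// ?nnegrE ?expR_ge0// expR_ge1Dx.
  rewrite -expRM_natl ler_expR mulrN lerN2 mulrA ler_pdivlMr//.
  by rewrite /V -natrX -!natrM ler_nat [(N * _)%N]mulnC.
apply: le_lt_trans (ler_wpM2l (ltW q0) le1) _.
rewrite expRN ltr_pdivrMr ?expR_gt0// mul1r -[b%:R]mulr1 expRM_natl.
rewrite ltrXn2r// ?lt0n_neq0//.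
by rewrite -[X in X < _]/(1 + 1 : R) expR_gt1Dx// oner_eq0.
Qed.

Definition mismatches (x y : nat -> bool) (n : nat) : nat :=
  (\sum_(j < n) (x j != y j))%N.

(** The final estimate of [covering_code] with logarithms as atoms: [l2], [lb], [lb'], [lV], [lc],
    [ld] stand for those of [2], [b], [b + 1], ['C(b, k)], [c], [1 - c]. *)
Lemma entropy_arith (R : realType) (l2 lb lb' lV lc ld c K b k a : R) :
  lV + a * l2 <= l2 + lb + b * l2 ->
  0 <= lb' + (lV + (k * lc + (b - k) * ld)) ->
  l2 + lb + lb' + (ld - lc) + l2 <= K * b ->
  b * c * (ld - lc) <= (k + 1) * (ld - lc) ->
  (a + 1) * l2 <= (l2 + c * lc + (1 - c) * ld + K) * b.
Proof. by move=> *; lra. Qed.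

(** By [binomial_mode], a sphere of radius about [c b] has at least [2^(H(c) b)] points up to a
    factor subexponential in [b], so about [2^((1 - H(c)) b)] centres suffice. The rate counts
    [a.+1] bits to include the marker bit of the machine inputs. *)
Lemma covering_code (R : realType) (c eta : R) : 0 < c -> c < 1 / 2 -> 0 < eta ->
  exists b a k (B : nat -> nat -> bool),
  [/\ (0 < b)%N, a.+1%:R <= (1 - Hbin c + eta) * b%:R, k%:R <= (c + eta) * b%:R &
     forall x, exists i, (i < 2 ^ a)%N /\ (mismatches x (B i) b <= k)%N].
Proof.
move=> c0 c12 eta0.
have d0 : 0 < 1 - c by lra.
have c1 : c <= 1 by lra.
have c01 : 0 < c < 1 by lra.
have l20 : 0 < ln 2 :> R by rewrite ln_gt0// ltr1n.
have lnX n (x : R) : 0 < x -> ln (x ^+ n) = n%:R * ln x.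
  by move=> x0; rewrite lnXn// mulr_natl.
pose L := ln (1 - c) - ln c.
have L0 : 0 <= L by rewrite subr_ge0 ler_ln ?posrE//; lra.
pose K := eta * ln 2; have K0 : 0 < K by rewrite mulr_gt0.
(* The first term lets the cubic term [(K b)^3 / 3!] of the exponential beat
   [4 b (b + 1) exp L <= 8 b^2 exp L], whence [48 = 8 * 6]; the second absorbs the rounding of
   [k]. *)
pose b := (Num.trunc (48 * expR L / K ^+ 3 + 1 / eta)).+1.
have bgt : 48 * expR L / K ^+ 3 + 1 / eta < b%:R by rewrite truncnS_gt.
have t1 : 0 < 48 * expR L / K ^+ 3 by rewrite !(divr_gt0, mulr_gt0, expR_gt0, exprn_gt0).
have t2 : 0 < 1 / eta by rewrite divr_gt0.
have b0 : (0 < b)%N by [].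
have bR0 : 0 < b%:R :> R by rewrite ltr0n.
have b1 : 1 <= b%:R :> R by rewrite ler1n.
have beta : 1 <= eta * b%:R.
  by rewrite mulrC -ler_pdivrMr//; apply: le_trans (ltW bgt); rewrite lerDr ltW.
have bK : 2 * b%:R * b.+1%:R * expR L * 2 <= expR (K * b%:R).
  have h : 48 * expR L <= b%:R * K ^+ 3.
    rewrite -ler_pdivrMr ?exprn_gt0//; apply: le_trans (ltW bgt); rewrite lerDl ltW//.
  have := expR_ge1Dxn 2 (mulr_ge0 (ltW K0) (ltW bR0)); apply: le_trans.
  apply: (@le_trans _ _ ((K * b%:R) ^+ 3 / 6)); last by rewrite lerDr.
  have -> : (K * b%:R) ^+ 3 / 6 = b%:R * K ^+ 3 * b%:R ^+ 2 / 6 by ring.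
  apply: (@le_trans _ _ (48 * expR L * b%:R ^+ 2 / 6)).
    rewrite -natr1; have := expR_gt0 L; set E := expR L => E0.
    have : 0 <= E * (b%:R * (b%:R - 1)) by rewrite !mulr_ge0 ?subr_ge0// ltW.
    by nra.
  by rewrite ler_pM2r ?invr_gt0// ler_pM2r ?exprn_gt0.
pose k := Num.trunc (b.+1%:R * c).
have kle : k%:R <= b.+1%:R * c by rewrite truncn_le// mulr_ge0// ltW.
have klt : b.+1%:R * c < k.+1%:R by rewrite truncnS_gt.
have kb : (k <= b)%N.
  by rewrite -ltnS -(ltr_nat R); apply: le_lt_trans kle _; rewrite gtr_pMr ?ltr0n//; case/andP: c01.
have V0 : (0 < 'C(b, k))%N by rewrite bin_gt0.
(* The least such exponent is taken: minimality bounds [2 ^ a] from above up to a factor 2, which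
   gives the rate. *)
have ex : exists a, (b * 2 ^ b <= 'C(b, k) * 2 ^ a)%N.
  exists (b + b)%N; apply: (@leq_trans (2 ^ (b + b))); last by rewrite leq_pmull.
  by rewrite expnD leq_mul2r (ltnW (ltn_expl _ _)) ?orbT.
pose a := ex_minn ex.
have [ha amax] : (b * 2 ^ b <= 'C(b, k) * 2 ^ a)%N /\ ('C(b, k) * 2 ^ a <= 2 * b * 2 ^ b)%N.
  rewrite /a; case: ex_minnP => -[|a'] ha amin; split=> //.
    rewrite muln1; have : ('C(b, k) <= 2 ^ b)%N.
      by rewrite -(card_sphere _ _ finset.set0) -card_subsets max_card.
    by move/leq_trans; apply; rewrite leq_pmull// muln_gt0.
  have : ~~ (b * 2 ^ b <= 'C(b, k) * 2 ^ a')%N by apply/negP => /amin; rewrite ltnn.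
  by rewrite -ltnNge expnS => lt; rewrite mulnCA -mulnA leq_mul2l ltnW.
have [l sl hl] := covering_of_volume R b k (2 ^ a) b0 ha.
exists b, a, k, (fun i j => if insub j is Some o then o \in nth finset.set0 l i else false).
split=> //.
- have mode : 1 <= b.+1%:R * ('C(b, k)%:R * (c ^+ k * (1 - c) ^+ (b - k))).
    by apply: binomial_mode => //; rewrite kle klt.
  have VR0 : 0 < 'C(b, k)%:R :> R by rewrite ltr0n.
  have h3 : 0 <= ln b.+1%:R + (ln 'C(b, k)%:R +
      (k%:R * ln c + (b%:R - k%:R) * ln (1 - c))).
    rewrite -ler_ln ?posrE ?ltr01 ?mulr_gt0 ?exprn_gt0 ?ltr0n// in mode.
    by rewrite ln1 !lnM ?posrE ?mulr_gt0 ?exprn_gt0 ?ltr0n// !lnX// natrB in mode.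
  have h2 : ln 'C(b, k)%:R + a%:R * ln 2 <= ln 2 + ln b%:R + b%:R * ln 2 :> R.
    have amaxR : 'C(b, k)%:R * 2 ^+ a <= 2 * b%:R * 2 ^+ b :> R.
      by rewrite -!natrX -!natrM ler_nat.
    rewrite -ler_ln ?posrE ?mulr_gt0 ?exprn_gt0 ?ltr0n// in amaxR.
    by rewrite !lnM ?posrE ?mulr_gt0 ?exprn_gt0 ?ltr0n// !lnX// in amaxR.
  have h1 : ln 2 + ln b%:R + ln b.+1%:R + L + ln 2 <= K * b%:R.
    rewrite -ler_ln ?posrE ?mulr_gt0 ?expR_gt0 ?ltr0n// expRK in bK.
    by rewrite !lnM ?posrE ?mulr_gt0 ?expR_gt0 ?ltr0n// expRK in bK.
  rewrite -(ler_pM2r l20) /Hbin.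
  have -> : (1 - (- c * (ln c / ln 2) - (1 - c) * (ln (1 - c) / ln 2)) + eta) * b%:R * ln 2
      = (ln 2 + c * ln c + (1 - c) * ln (1 - c) + K) * b%:R.
    by rewrite /K; field; rewrite gt_eqF.
  (* Since [c < 1 / 2] makes [L] nonnegative, rounding [k] down costs at most [L]. *)
  have kL : (b%:R * c) * L <= (k%:R + 1) * L.
    by rewrite ler_wpM2r// natr1; apply: le_trans (ltW klt); rewrite ler_wpM2r ?ltW// ltr_nat.
  by rewrite -natr1; exact: entropy_arith h2 h3 h1 kL.
- apply: le_trans kle _; rewrite -natr1 !mulrDl mul1r [c * _]mulrC lerD2l.
  exact: le_trans c1 beta.
- move=> x; have /hasP[y yl /eqP hy] := hl [set j : 'I_b | x j]%SET.
  exists (index y l); split; first by rewrite -sl index_mem.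
  rewrite -hy /hamming /mismatches -sum1_card [leqRHS]big_mkcond.
  apply: leq_sum => j _; rewrite valK nth_index// !inE.
  by case: (_ != _).
Qed.

(** * Complexity, dimension and distance *)

Lemma KC_le_size (R : realType) U q sigma :
  runs U q sigma -> KC U sigma <= (size q)%:R :> R.
Proof. by move=> Uq; apply: ge_inf; [exists 0 => _ [p _ <-] | exists q]. Qed.

(* [KC] is [0] on a word without program ([inf] of the empty set), hence the
   positivity hypothesis. *)
Lemma KC_lt_program (R : realType) U sigma (r : R) :
  0 < KC U sigma :> R -> KC U sigma < r -> exists2 p, runs U p sigma & (size p)%:R < r.
Proof.
move=> pos lt; have [|_ [p Up <-] ltp] := inf_lt _ lt; last by exists p.
apply/set0P/eqP => e; move: pos; rewrite /KC; rewrite e inf0 ltxx//.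
Qed.

(** The liminf is the supremum of the tail infima. As [s > 0], some tail has positive quotients, so
    its values come from actual programs; as every tail infimum is at most [s < r], values below [r]
    occur arbitrarily late. *)
Lemma dimK_low_programs (R : realType) U X (s r : R) : dimK U X = s%:E ->
  0 < s -> s < r ->
  forall N : nat, exists n p, [/\ (N <= n)%N, runs U p (restr X n) & (size p)%:R < r * n%:R].
Proof.
set u := fun n => ((KC U (restr X n) : R) / n%:R)%:E.
rewrite /dimK -/u limn_einf_lim => hs s0 sr N.
have lim_sup : limn (einfs u) = ereal_sup (range (einfs u))%classic.
  by apply/cvg_lim => //; exact: cvg_einfs_sup.
have [N1 hN1] : exists N1, forall n, (N1 <= n)%N -> (0%E < u n)%E.
  have : (0%E < ereal_sup (range (einfs u))%classic)%E by rewrite -lim_sup hs lte_fin.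
  move=> /ereal_sup_gt[_ [N1 _ <-] lt]; exists N1 => n nN1.
  by apply: lt_le_trans lt _; apply: ereal_inf_lbound; exists n.
have : (einfs u (maxn N N1) < r%:E)%E.
  apply: le_lt_trans (_ : _ <= s%:E)%E _; last by rewrite lte_fin.
  by rewrite -hs lim_sup; apply: ereal_sup_ubound; exists (maxn N N1).
move=> /ereal_inf_lt[_ [n /= nN <-]]; rewrite lte_fin => lt.
move: nN; rewrite geq_max => /andP[nN nN1].
have := hN1 n nN1; rewrite /u lte_fin => pos.
have n0 : 0 < n%:R :> R.
  by rewrite ltr0n lt0n; apply: contraTN pos => /eqP ->; rewrite invr0 mulr0 ltxx.
have [||p Up lp] := KC_lt_program R U (restr X n) (r * n%:R).
- by move: pos; rewrite pmulr_lgt0// invr_gt0.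
- by rewrite -ltr_pdivrMr.
by exists n, p.
Qed.

Lemma dimK_le (R : realType) U Z (t : R) :
  (forall (eps : R) (N : nat), 0 < eps ->
    exists2 n, (N < n)%N & KC U (restr Z n) <= (t + eps) * n%:R) ->
  (dimK U Z <= t%:E)%E.
Proof.
move=> H; rewrite /dimK limn_einf_lim.
apply/lee_addgt0Pr => eps eps0; apply: lime_le; first exact: is_cvg_einfs.
apply: nearW => N; have [n Nn hn] := H eps N eps0.
have n0 : (0 < n)%N by apply: leq_ltn_trans Nn.
apply: (@le_trans _ _ ((KC U (restr Z n) : R) / n%:R)%:E).
  by apply: ereal_inf_lbound; exists n => //=; exact: ltnW.
by rewrite lee_fin ler_pdivrMr// ltr0n.
Qed.

Lemma dist_le (R : realType) X Z (D : R) :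
  (forall eps : R, 0 < eps -> exists N : nat, forall n, (N <= n)%N ->
    (mismatches X Z n)%:R <= (D + eps) * n%:R) ->
  (dist X Z <= D%:E)%E.
Proof.
move=> H; rewrite /dist limn_esup_lim.
apply/lee_addgt0Pr => eps eps0; have [N hN] := H eps eps0.
apply: lime_le; first exact: is_cvg_esups.
exists N.+1 => // M /= NM; apply: ge_ereal_sup => _ [n /= Mn <-].
have n0 : (0 < n)%N by apply: leq_trans Mn; apply: leq_trans NM.
rewrite lee_fin ler_pdivrMr ?ltr0n//.
suff -> : #|[set m : 'I_n | X m != Z m]%classic| = mismatches X Z n.
  by apply: hN; apply: ltnW; apply: leq_trans Mn.
rewrite /mismatches -sum1_card big_mkcond; apply: eq_bigr => i _.
exact: (congr1 nat_of_bool (asboolb (X i != Z i))).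
Qed.

Lemma wordE T i : word T i = nth [::] T (if (i < size T)%N then i else 0%N).
Proof.
rewrite /word; case: ltnP => h; first exact: set_nth_default.
by rewrite nth_default// nth0; case: T h.
Qed.

(** The constant depends on the code, [u] and [w], but not on [p], [s] or [l]: this order of
    quantifiers lets a long prefix absorb it. The lone [1] pays for the terminating bit. *)
Lemma append_KC (R : realType) U (a b : nat) (B : nat -> nat -> bool) (u w : seq bool) :
  optimal_pf_machine U -> exists C : nat, forall p s l,
    runs U p (u ++ s) -> all (fun i => (i < 2 ^ a)%N) l ->
    KC U (w ++ s ++ flatten [seq mkseq (B i) b | i <- l])
      <= (size p + a.+1 * size l + 1 + C)%:R :> R.
Proof.
move=> [pfU optU].
(* Each index is transmitted as its own [a]-bit word behind the marker [true]. *)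
pose A := [seq true :: val t | t <- enum {: a.-tuple bool}].
pose T := mkseq (fun i => mkseq (B i) b) (2 ^ a).
have sA : size A = (2 ^ a)%N by rewrite size_map -cardE card_tuple card_bool.
have sT : size T = (2 ^ a)%N by rewrite size_mkseq.
have uA : uniq A.
  by rewrite map_inj_uniq ?enum_uniq// => x y [] /val_inj.
have lt i : ((if (i < 2 ^ a)%N then i else 0) < 2 ^ a)%N.
  by case: ifP => //; rewrite expn_gt0.
have mA i : marked a.+1 (word A i).
  have : word A i \in A by rewrite wordE mem_nth// sA.
  by move=> /mapP[t _ ->]; rewrite /marked /= size_tuple.
have AT i j : word A i = word A j -> word T i = word T j.
  rewrite !wordE sA sT => /eqP; rewrite nth_uniq ?sA//.
  by move=> /eqP ->.
have [M [pfM hM]] := append_machine U pfU _ _ _ u w mA AT.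
have [C hC] := optU _ pfM; exists C => p s l Up al.
have [q [Uq sq]] := hC _ _ (hM p s l Up).
have e : subst_words T l = flatten [seq mkseq (B i) b | i <- l].
  rewrite /subst_words; congr flatten; apply/eq_in_map => i /(allP al) il.
  by rewrite wordE sT il nth_mkseq.
rewrite -e; apply: le_trans (KC_le_size R _ _ _ Uq) _; rewrite ler_nat.
apply: leq_trans sq _; rewrite size_cat /= /subst_words size_flatten.
have -> : sumn (shape [seq word A i | i <- l]) = (a.+1 * size l)%N.
  elim: l {Up al e Uq} => [|i l IH] /=; first by rewrite muln0.
  by rewrite mulnS -IH; case: (mA i) => ->.
by rewrite leq_add2r addnS addn1 ltnS addnC.
Qed.

(** * Counting mismatches along a sequence *)

Lemma mismatches_cat x y n l : mismatches x y (n + l) =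
  (mismatches x y n + mismatches (fun j => x (n + j)%N) (fun j => y (n + j)%N) l)%N.
Proof. by rewrite /mismatches big_split_ord. Qed.

Lemma mismatches_eq x y x' y' n : (forall j, (j < n)%N -> x j = x' j /\ y j = y' j) ->
  mismatches x y n = mismatches x' y' n.
Proof. by move=> H; apply: eq_bigr => j _; have [-> ->] := H j (ltn_ord j). Qed.

Lemma mismatches0 x y n : (forall j, (j < n)%N -> x j = y j) -> mismatches x y n = 0%N.
Proof. by move=> H; rewrite /mismatches big1// => j _; rewrite H// eqxx. Qed.

Lemma mismatches_le_size x y n : (mismatches x y n <= n)%N.
Proof.
rewrite -[leqRHS]card_ord -sum1_card; apply: leq_sum => j _; exact: leq_b1.
Qed.

Lemma mismatches_mono x y m n : (m <= n)%N -> (mismatches x y m <= mismatches x y n)%N.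
Proof. by move=> /subnKC <-; rewrite mismatches_cat leq_addr. Qed.

Lemma mismatches_tail x y n0 n : (forall j, (n0 <= j)%N -> x j = y j) ->
  (mismatches x y n <= mismatches x y n0)%N.
Proof.
move=> H; case: (leqP n n0) => [|/ltnW]; first exact: mismatches_mono.
move=> /subnKC <-; rewrite mismatches_cat [X in (_ + X)%N]mismatches0 ?addn0//.
by move=> j _; rewrite H// leq_addr.
Qed.

(** A chunk cut off by [l] is charged in full, hence the successor. *)
Lemma mismatches_blocks x y b k l : (0 < b)%N ->
  (forall i, (mismatches (fun j => x (i * b + j)%N) (fun j => y (i * b + j)%N) b <= k)%N) ->
  (mismatches x y l <= k * (l %/ b).+1)%N.
Proof.
move=> b0 H; have blocks i : (mismatches x y (i * b) <= k * i)%N.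
  elim: i => [|i IH]; first by rewrite mul0n /mismatches big_ord0.
  by rewrite mulSnr mismatches_cat mulnS addnC leq_add.
apply: leq_trans (blocks _); apply: mismatches_mono.
exact: ltnW (ltn_ceil _ b0).
Qed.

Lemma mkseq_cat (T : Type) (f : nat -> T) m n :
  mkseq f (m + n) = mkseq f m ++ mkseq (fun j => f (m + j)%N) n.
Proof. by rewrite /mkseq iotaD map_cat add0n -[X in iota X n]addn0 iotaDl -map_comp. Qed.

Lemma mkseq_blocks (T : Type) (f : nat -> T) b m :
  mkseq f (m * b) = flatten (mkseq (fun i => mkseq (fun j => f (i * b + j)%N) b) m).
Proof.
elim: m => [//|m IH]; rewrite mulSnr mkseq_cat IH.
by rewrite [in RHS]mkseqS flatten_rcons.
Qed.

(** * One block *)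

(** The new prefix has the shape produced by [append_KC]. Mismatches lie below [N0], charged [N0] in
    all, or in the new block; the bound holds at every [r], also inside the block, as a limsup
    demands. *)
Lemma splice_codewords (a b k : nat) (B : nat -> nat -> bool) (X Z0 : nat -> bool)
    (N0 n m : nat) : (0 < b)%N ->
  (forall x, exists i, (i < 2 ^ a)%N /\ (mismatches x (B i) b <= k)%N) ->
  (forall j, (N0 <= j)%N -> Z0 j = X j) -> (N0 <= n)%N ->
  exists Z1 l, [/\ size l = m, all (fun i => (i < 2 ^ a)%N) l,
    restr Z1 (n + m * b) = restr Z0 N0 ++ mkseq (fun j => X (N0 + j)%N) (n - N0) ++
      flatten [seq mkseq (B i) b | i <- l],
    (forall j, (j < n)%N -> Z1 j = Z0 j) /\ (forall j, (n + m * b <= j)%N -> Z1 j = X j) &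
    forall r, (mismatches X Z1 (n + r) <= N0 + k * (minn r (m * b) %/ b).+1)%N].
Proof.
move=> b0 /choice[f hf] ZX Nn.
pose idx i := f (fun j => X (n + (i * b + j))%N).
pose Z1 j := if (j < n)%N then Z0 j else
  if (j < n + m * b)%N then B (idx ((j - n) %/ b)%N) ((j - n) %% b)%N else X j.
have Z1n j : (j < n)%N -> Z1 j = Z0 j by rewrite /Z1 => ->.
have Z1X j : (n + m * b <= j)%N -> Z1 j = X j.
  by move=> h; rewrite /Z1 !ltnNge h (leq_trans (leq_addr _ _) h).
have Z1B i j : (i < m)%N -> (j < b)%N -> Z1 (n + (i * b + j))%N = B (idx i) j.
  move=> im jb; have lt : (i * b + j < m * b)%N.
    by apply: (@leq_trans (i.+1 * b)); [rewrite mulSnr ltn_add2l | rewrite leq_mul2r im orbT].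
  by rewrite /Z1 ltnNge leq_addr ltn_add2l lt addKn divnMDl// divn_small// addn0 modnMDl modn_small.
exists Z1, (mkseq idx m); split=> //.
- by rewrite size_mkseq.
- by apply/allP => _ /mapP[i _ ->]; case: (hf (fun j => X (n + (i * b + j))%N)).
- rewrite /restr mkseq_cat mkseq_blocks -{1}(subnKC Nn) mkseq_cat -catA.
  congr (_ ++ (_ ++ _)).
  + by apply/eq_in_map => j; rewrite mem_iota => /andP[_ jN]; rewrite Z1n// (leq_trans jN).
  + apply/eq_in_map => j; rewrite mem_iota add0n ltn_subRL => /andP[_ jN].
    by rewrite Z1n// ZX// leq_addr.
  + congr flatten; rewrite /mkseq -map_comp; apply/eq_in_map => i; rewrite mem_iota => /andP[_ im].
    by apply/eq_in_map => j; rewrite mem_iota => /andP[_ jb]; rewrite Z1B.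
move=> r; rewrite mismatches_cat; apply: leq_add.
  apply: (@leq_trans (mismatches X Z0 n)); last first.
    apply: leq_trans (mismatches_le_size X Z0 N0).
    by apply: mismatches_tail => j /ZX.
  by rewrite (mismatches_eq _ _ X Z0)// => j jn; rewrite Z1n.
set x := fun j => X _; set y := fun j => Z1 _.
apply: (@leq_trans (mismatches x y (minn r (m * b)))).
  case: (leqP r (m * b)) => // _; apply: mismatches_tail => j h.
  by rewrite /x /y Z1X// leq_add2l.
apply: mismatches_blocks => // i; case: (ltnP i m) => im.
  rewrite (mismatches_eq _ _ (fun j => X (n + (i * b + j))%N) (B (idx i))).
    by case: (hf (fun j => X (n + (i * b + j))%N)).
  by move=> j jb; rewrite /y Z1B.
rewrite mismatches0// => j jb; rewrite /x /y Z1X// leq_add2l.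
by apply: (@leq_trans (i * b)); rewrite ?leq_addr// leq_mul2r im orbT.
Qed.

(* [h] is the rate of the code, [m] the number of chunks, [p] the length of a
   program for the prefix of length [n], and [C] the optimality constant. *)
Lemma splice_rate (R : realType) (s t h c rho eta b a n m p C : R) :
  0 < eta -> 0 < rho -> h * rho + s = t * (1 + rho) -> 0 <= h + eta ->
  h <= t -> a <= (h + eta) * b -> 0 <= n -> 0 <= m ->
  m * b <= rho * n -> rho * n - b <= m * b -> 0 <= b ->
  p <= (s + eta) * n -> (t + 2 * eta) * b + C + 1 <= eta * n ->
  p + a * m + 1 + C <= (t + 2 * eta) * (n + m * b).
Proof.
move=> eta0 rho0 e he ht ha n0 m0 mb mb' b0 hp hn.
have h1 : a * m <= (h + eta) * b * m by rewrite ler_wpM2r.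
have h2 : (h + eta) * (m * b) <= (h + eta) * (rho * n) by rewrite ler_wpM2l.
have t0 : 0 <= t + 2 * eta by lra.
have h3 : (t + 2 * eta) * (n + (rho * n - b)) <= (t + 2 * eta) * (n + m * b).
  by rewrite ler_wpM2l// lerD2l.
have h4 : h * rho * n + s * n = t * (1 + rho) * n by rewrite -mulrDl e.
have h5 : 0 <= eta * rho * n by rewrite !mulr_ge0// ltW.
by apply: le_trans h3; move: h1 h2 h4 h5 hp hn; clear; lra.
Qed.

(** Here [l] counts the positions of the block already passed and [q] its complete chunks. The ratio
    [c l / (n + l)] increases with [l], so its worst value is [D], at [l = rho n]. *)
Lemma splice_dist (R : realType) (c rho D eta b k n l r N0 q : R) :
  0 < eta -> 0 < rho -> 0 < c -> D * (1 + rho) = c * rho -> 0 <= b ->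
  k <= (c + eta) * b -> 0 <= n -> l <= rho * n -> l <= r -> 0 <= q -> q * b <= l ->
  N0 + (c + eta) * b <= eta * n ->
  N0 + k * (q + 1) <= (D + 2 * eta) * (n + r).
Proof.
move=> eta0 rho0 c0 e b0 hk n0 ln lr q0 qb hn.
have l0 : 0 <= l by apply: le_trans qb; rewrite mulr_ge0.
have r0 : 0 <= r := le_trans l0 lr.
have h1 : k * (q + 1) <= (c + eta) * b * (q + 1) by rewrite ler_wpM2r// addr_ge0.
have h2 : (c + eta) * (q * b) <= (c + eta) * l by rewrite ler_wpM2l// addr_ge0// ltW.
have h3 : eta * l <= eta * r by rewrite ler_wpM2l// ltW.
have D0 : 0 <= D.
  by rewrite -(pmulr_lge0 _ (_ : 0 < 1 + rho)) ?e ?mulr_ge0 ?addr_gt0// ltW.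
have h4 : c * l <= D * (n + r).
  apply: (@le_trans _ _ (D * (n + l))); last by rewrite ler_wpM2l// lerD2l.
  rewrite -(ler_pM2r (_ : 0 < 1 + rho)) ?addr_gt0//.
  have -> : D * (n + l) * (1 + rho) = c * rho * (n + l) by rewrite -e; ring.
  have : c * l <= c * (rho * n) by rewrite ler_wpM2l// ltW.
  by clear; lra.
have h5 : 0 <= eta * n by rewrite mulr_ge0// ltW.
have h6 : 0 <= eta * r by rewrite mulr_ge0// ltW.
by move: h1 h2 h3 h4 h5 h6 hn; clear; lra.
Qed.

(** The mismatch clause is split at the start [n] of the block: before it the counts of [Z0]
    persist, from it on the bound holds for all lengths. Successive stages can thus hand the bound
    over without a gap. *)
Lemma stage (R : realType) U (s c t : R) (X : nat -> bool) :
  optimal_pf_machine U -> 0 < s -> dimK U X = s%:E -> 0 < c -> c < 1 / 2 ->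
  1 - Hbin c < t -> t < s ->
  forall (eps : R) (Z0 : nat -> bool) (N0 : nat), 0 < eps ->
  (forall j, (N0 <= j)%N -> Z0 j = X j) ->
  exists (Z1 : nat -> bool) (N1 : nat),
  [/\ (N0 < N1)%N, (forall j, (N0 > j)%N -> Z1 j = Z0 j),
    (forall j, (N1 <= j)%N -> Z1 j = X j),
    KC U (restr Z1 N1) <= (t + eps) * N1%:R &
    exists2 n, (n <= N1)%N & forall j,
      if (j < n)%N then mismatches X Z1 j = mismatches X Z0 j
      else (mismatches X Z1 j)%:R <= (c / (s - 1 + Hbin c) * (s - t) + eps) * j%:R].
Proof.
move=> optU s0 dimX c0 c12 ht ts eps Z0 N0 eps0 ZX.
set h := 1 - Hbin c in ht; pose rho := (s - t) / (t - h).
have th : 0 < t - h by rewrite subr_gt0.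
have st : 0 < s - t by rewrite subr_gt0.
have rho0 : 0 < rho by rewrite divr_gt0.
have e1 : h * rho + s = t * (1 + rho).
  by rewrite /rho; field; rewrite gt_eqF.
have -> : s - 1 + Hbin c = s - h by rewrite /h; ring.
have sh : 0 < s - h by rewrite subr_gt0 (lt_trans ht).
have e2 : c / (s - h) * (s - t) * (1 + rho) = c * rho.
  by rewrite /rho; field; rewrite !gt_eqF.
set D := c / _ * _ in e2 *.
pose eta := eps / 2; have eta0 : 0 < eta by rewrite divr_gt0.
have -> : eps = 2 * eta by rewrite /eta mulrC divfK.
have [b [a [k [B [b0 ha hk hB]]]]] := covering_code R c eta c0 c12 eta0.
have bR0 : 0 < b%:R :> R by rewrite ltr0n.
have he : 0 <= h + eta.
  by rewrite -(pmulr_lge0 _ bR0); apply: le_trans ha.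
(* The machine exchanges the first [N0] bits of [X] for the modified ones of [Z0]. *)
have [C hC] := append_KC R U a b B (restr X N0) (restr Z0 N0) optU.
(* Three thresholds: [n] must pass the part already modified, absorb the constants of [splice_rate],
   and absorb [N0] plus one chunk in [splice_dist]. *)
pose N := maxn N0.+1 (maxn (Num.trunc (((t + 2 * eta) * b%:R + C%:R + 1) / eta)).+1
  (Num.trunc ((N0%:R + (c + eta) * b%:R) / eta)).+1).
have sse : s < s + eta by rewrite ltrDl.
have [n [p [Nn Up sp]]] := dimK_low_programs R U X s (s + eta) dimX s0 sse N.
move: Nn; rewrite !geq_max => /and3P[nN0 n1 n2].
have big (y : R) : ((Num.trunc (y / eta)).+1 <= n)%N -> y <= eta * n%:R.
  move=> yn; rewrite mulrC -ler_pdivrMr//; apply: ltW.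
  by apply: lt_le_trans (truncnS_gt _) _; rewrite ler_nat.
pose m := Num.trunc (rho * n%:R / b%:R).
have rn0 : 0 <= rho * n%:R / b%:R by rewrite !mulr_ge0 ?invr_ge0 ?ler0n// ltW.
have mb : m%:R * b%:R <= rho * n%:R by rewrite -ler_pdivlMr// truncn_le.
have mb' : rho * n%:R - b%:R <= m%:R * b%:R.
  rewrite lerBlDr -{2}[b%:R]mul1r -mulrDl natr1 -ler_pdivrMr//.
  exact: ltW (truncnS_gt _).
have [Z1 [l [sl al eZ [Z1n Z1X] hd]]] := splice_codewords a b k B X Z0 N0 n m b0 hB ZX (ltnW nN0).
exists Z1, (n + m * b)%N; split=> //.
- by rewrite (leq_trans nN0)// leq_addr.
- by move=> j jN0; apply: Z1n; rewrite (leq_trans jN0)// ltnW.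
- rewrite eZ; apply: le_trans (hC p _ _ _ al) _.
    by move: Up; rewrite {1}/restr -{1}(subnKC (ltnW nN0)) mkseq_cat.
  rewrite sl !natrD !natrM -{1}[m%:R]mul1r -mulrDl nat1r.
  by apply: (@splice_rate R s t h c rho eta) => //; [exact: ltW | exact: ltW | exact: big].
exists n; first by rewrite leq_addr.
move=> j; case: ltnP => [jn|/subnKC <-].
  by apply: mismatches_eq => i ij; rewrite Z1n// (ltn_trans ij).
apply: le_trans (_ : (N0 + k * (minn (j - n) (m * b) %/ b).+1)%:R <= _); first by rewrite ler_nat.
rewrite !natrD natrM -natr1.
have lm : (minn (j - n) (m * b) <= m * b)%N by rewrite geq_minr.
apply: (@splice_dist R c rho D eta b%:R _ _ (minn (j - n) (m * b))%:R) => //.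
- by apply: le_trans mb; rewrite -natrM ler_nat.
- by rewrite ler_nat geq_minl.
- by rewrite -natrM ler_nat leq_trunc_div.
- exact: big.
Qed.

(** * Iteration of the block construction *)

Theorem theorem4p5 (R : realType) (U : pcode) (hU : optimal_pf_machine U)
  (s : R) (hs0 : 0 < s) (hs1 : s < 1)
  (X : nat -> bool) (hX : dimK U X = s%:E)
  (t : R) (ht1 : 1 - Hbin (1 - 2 `^ (s - 1)) < t) (ht2 : t < s) :
  let c := 1 - 2 `^ (s - 1) in
  exists Z : nat -> bool,
    (dimK U Z <= t%:E)%E /\
    (dist X Z <= (c / (s - 1 + Hbin c) * (s - t))%:E)%E.
Proof.
move=> c.
have c0 : 0 < c.
  rewrite subr_gt0 /powR gt_eqF// expR_lt1 pmulr_llt0 ?subr_lt0//.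
  by rewrite ln_gt0// ltr1n.
(* From [2 * 2^(s - 1) = 2^s > 1]. *)
have c12 : c < 1 / 2.
  have := mulr_powRB1 (ler0n R 2) hs0.
  have : 1 < 2 `^ s :> R by rewrite /powR gt_eqF// expR_gt1 mulr_gt0// ln_gt0// ltr1n.
  by rewrite /c; lra.
set D := c / _ * _.
pose eps (i : nat) : R := i.+1%:R^-1.
have eps0 i : 0 < eps i by rewrite invr_gt0 ltr0n.
pose good (st : (nat -> bool) * nat) := forall j, (st.2 <= j)%N -> st.1 j = X j.
pose next (i : nat) (st st' : (nat -> bool) * nat) :=
  [/\ (st.2 < st'.2)%N, (forall j, (j < st.2)%N -> st'.1 j = st.1 j), good st',
    KC U (restr st'.1 st'.2) <= (t + eps i) * st'.2%:R &
    exists2 n, (n <= st'.2)%N & forall j,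
      if (j < n)%N then mismatches X st'.1 j = mismatches X st.1 j
      else (mismatches X st'.1 j)%:R <= (D + eps i) * j%:R].
(* Goodness is placed under the existential so that choice gives a function on all states; a bad
   state is simply returned. *)
have /choice[f hf] : forall a : nat * ((nat -> bool) * nat),
    exists st', good a.2 -> next a.1 a.2 st'.
  move=> [i [Z0 N0]] /=; have [g|ng] := pselect (good (Z0, N0)); last by exists (Z0, N0).
  have [Z1 [N1 H]] := stage R U s c t X hU hs0 hX c0 c12 ht1 ht2 (eps i) Z0 N0 (eps0 i) g.
  by exists (Z1, N1).
pose S := fix S i := if i is i'.+1 then f (i', S i') else (X, 0%N).
have gS i : good (S i).
  by elim: i => [//|i IH]; have [] := hf (i, S i) IH.
have nS i : next i (S i) (S i.+1) := hf (i, S i) (gS i).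
have lenS i : (i <= (S i).2)%N.
  by elim: i => [//|i IH]; have [lt _ _ _ _] := nS i; apply: leq_ltn_trans lt.
have lenD i d : ((S i).2 <= (S (i + d)%N).2)%N.
  elim: d => [|d IH]; first by rewrite addn0.
  by rewrite addnS; have [lt _ _ _ _] := nS (i + d)%N; apply: leq_trans IH (ltnW lt).
have stable i d j : (j < (S i).2)%N -> (S (i + d)%N).1 j = (S i).1 j.
  move=> ji; elim: d => [|d IH]; first by rewrite addn0.
  rewrite addnS; have [_ eq _ _ _] := nS (i + d)%N; rewrite eq//.
  exact: leq_trans ji (lenD i d).
(* Stage [j.+1] has already fixed more than [j] positions, so the bit at [j] is final there. *)
pose Z j := (S j.+1).1 j.
have ZS i j : (j < (S i).2)%N -> Z j = (S i).1 j.
  move=> ji; have jj : (j < (S j.+1).2)%N := lenS j.+1.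
  rewrite /Z; case: (leqP i j.+1) => [/subnKC <-|/ltnW/subnKC <-]; first exact: stable.
  by rewrite stable.
have epsS (e : R) : 0 < e -> exists i0 : nat, forall i, (i0 <= i)%N -> eps i <= e.
  move=> e0; exists (Num.trunc e^-1) => j ij.
  rewrite -[e]invrK lef_pV2 ?posrE ?invr_gt0 ?ltr0n//.
  by apply: le_trans (ltW (truncnS_gt _)) _; rewrite ler_nat.
exists Z; split.
- apply: dimK_le => e N e0; have [i0 hi0] := epsS e e0.
  pose i := maxn i0 N; exists (S i.+1).2.
    by apply: leq_trans (lenS i.+1); rewrite ltnS leq_maxr.
  have -> : restr Z (S i.+1).2 = restr (S i.+1).1 (S i.+1).2.
    by apply/eq_in_map => j; rewrite mem_iota => /andP[_ ji]; exact: ZS.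
  have [_ _ _ le _] := nS i; apply: le_trans le _.
  by rewrite ler_wpM2r// lerD2l hi0// leq_maxl.
- apply: dist_le => e e0; have [i0 hi0] := epsS e e0.
  have bound i j : ((S i.+1).2 <= j)%N -> (mismatches X (S i.+1).1 j)%:R <= (D + eps i) * j%:R.
    move=> ij; have [_ _ _ _ [n nle /(_ j)]] := nS i.
    by rewrite ltnNge (leq_trans nle ij).
  exists (S i0.+1).2 => n hn.
  (* The length [n] is located between the ends of two consecutive stages, so that [Z] agrees below
     [n] with the later one. *)
  have [d] : exists d, ((S (i0.+1 + d)%N).2 <= n < (S (i0.+1 + d.+1)%N).2)%N.
    have ex : exists d, (n < (S (i0.+1 + d)%N).2)%N.
      by exists n; apply: leq_trans (lenS _); rewrite addSn ltnS leq_addl.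
    case: (ex_minnP ex) => -[|d]; first by rewrite addn0 ltnNge hn.
    move=> lt dmin; exists d; rewrite lt andbT leqNgt; apply/negP => /dmin.
    by rewrite ltnn.
  rewrite addSn addnS; set i := (i0 + d)%N => /andP[lo hi].
  rewrite (mismatches_eq _ _ X (S i.+2).1); last by move=> j jn; rewrite (ZS i.+2)// (ltn_trans jn).
  have le e' : e' <= e -> (D + e') * n%:R <= (D + e) * n%:R.
    by move=> ee; rewrite ler_wpM2r// lerD2l.
  (* Before the later block starts, the bound of the earlier stage applies; afterwards that of the
     later stage does. *)
  have [_ _ _ _ [m _ /(_ n)]] := nS i.+1; case: ifP => _.
    move=> ->; apply: le_trans (bound _ _ lo) (le _ (hi0 _ (leq_addr _ _))).
  by move/le_trans; apply; apply: le; apply: hi0; rewrite leqW// leq_addr.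
Qed.
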